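(* For every $n\ge1$ and every permutation $\pi\in\mathfrak S_n$, $\psi(\pi)=\varepsilon(f(\pi))$.
   Context: $\mathfrak S_n$ is the symmetric group on $[n]$ in one-line notation; $\mathfrak S_0=\{\emptyset\}$. For $n\ge1$, $Y_n$ is the set of planar binary trees with $n$ internal nodes ($n+1$ leaves ordered left to right); $Y_0=\{\ast\}$, the trivial one-vertex tree. For $T_1\in Y_p,T_2\in Y_q$, $T_1\vee T_2\in Y_{p+q+1}$ is the tree with a new root having left subtree $T_1$ and right subtree $T_2$. For a word $a$ of distinct integers, $\mathrm{std}(a)$ is its standardization (smallest letter becomes 1, next 2, etc.; $\mathrm{std}(\emptyset)=\emptyset$). Loday–Ronco map $\psi:\mathfrak S_n\to Y_n$: $\psi(\emptyset)=\ast$; for $n>0$ write $\pi=\pi_L\,n\,\pi_R$ (the subwords to the left and right of the entry $n$), and set $\psi(\pi)=\psi(\mathrm{std}(\pi_L))\vee\psi(\mathrm{std}(\pi_R))$. Indexed terms: $\mathcal L^I$ is generated by symbols $\mathbf 2^k$ ($k$ a positive integer) of arity $2$, and for terms $\mathbf A,\mathbf B$ and $1\le m\le|\mathbf A|$ the term $\mathbf A\circ_m\mathbf B$ of arity $|\mathbf A|+|\mathbf B|-1$; no index occurs twice in a term. The evaluation $\varepsilon$ forgets indices, sends $\mathbf 2^k$ to the 2-corolla and $\mathbf A\circ_m\mathbf B$ to the tree obtained by grafting the root of $\varepsilon(\mathbf B)$ onto the $m$-th leaf of $\varepsilon(\mathbf A)$. Decreasing encoding: for a nonempty word $a=a_1\cdots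 a_r$ of distinct positive integers, let $\kappa_1>\kappa_2>\cdots>\kappa_r$ be its letters in decreasing order, and for a letter $x$ of $a$ let $u_a(x)$ be the number of letters of $a$ to the left of $x$ that are greater than $x$. Then $f(a)=\mathbf 2^{\kappa_1}$ if $r=1$, and otherwise $f(a)=(\cdots((\mathbf 2^{\kappa_1}\circ_{m_2}\mathbf 2^{\kappa_2})\circ_{m_3}\mathbf 2^{\kappa_3})\cdots)\circ_{m_r}\mathbf 2^{\kappa_r}$ with $m_q=u_a(\kappa_q)+1$. *)

(* Defs.v *)
From mathcomp Require Import all_boot all_fingroup.
From mathcomp Require Import zify.

Set Implicit Arguments.
Unset Strict Implicit.
Unset Printing Implicit Defensive.

Inductive bintree := Leaf | Node of bintree & bintree.

Fixpoint nnodes (t : bintree) : nat :=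
  if t is Node l r then (nnodes l + nnodes r).+1 else 0.

Fixpoint nleaves (t : bintree) : nat :=
  if t is Node l r then nleaves l + nleaves r else 1.

Definition corolla2 : bintree := Node Leaf Leaf.

(* Leaves are numbered 1, ..., nleaves t from left to right; if m is not in this
   range, graft t m s is t. *)
Fixpoint graft (t : bintree) (m : nat) (s : bintree) : bintree :=
  match t with
  | Leaf => if m == 1 then s else Leaf
  | Node l r => if m <= nleaves l then Node (graft l m s) r
                else Node l (graft r (m - nleaves l) s)
  end.

Lemma nleaves_nnodes t : nleaves t = (nnodes t).+1.
Proof. by elim: t => //= l -> r ->; rewrite addnS addSn. Qed.

Lemma nnodes_graft t m s :
  1 <= m <= nleaves t -> nnodes (graft t m s) = nnodes t + nnodes s.
Proof.
elim: t m => [|l IHl r IHr] m /=; first by move=> hm; have -> : m == 1 by lia.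
move=> hm; case: leqP => hl /=; first by rewrite IHl; lia.
by rewrite IHr; lia.
Qed.

Definition std (a : seq nat) : seq nat :=
  [seq (count (fun y => y < x) a).+1 | x <- a].

Definition oneline (n : nat) (pi : 'S_n) : seq nat :=
  [seq (pi i : nat).+1 | i <- enum 'I_n].

Lemma size_std a : size (std a) = size a.
Proof. exact: size_map. Qed.

Lemma std_perm a : uniq a -> perm_eq (std a) (iota 1 (size a)).
Proof.
move=> ua.
have H x y : x \in a -> x < y -> count (fun z => z < x) a < count (fun z => z < y) a.
  move=> xa xy.
  have := perm_to_rem xa => /seq.permP pa.
  rewrite !pa /= xy ltnn add0n add1n ltnS.
  by apply: sub_count => z /=; move: xy; lia.
have us : uniq (std a).
  rewrite map_inj_in_uniq // => x y xa ya [] e.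
  by case: (ltngtP x y) => // h; [have := H _ _ xa h | have := H _ _ ya h]; rewrite e ltnn.
have sub : {subset std a <= iota 1 (size a)}.
  move=> _ /mapP[x xa ->]; rewrite mem_iota add1n ltnS /=.
  have := perm_to_rem xa => pa; rewrite (perm_size pa) (seq.permP pa) /= ltnn add0n ltnS.
  exact: count_size.
apply: uniq_perm => //; first exact: iota_uniq.
by apply: (uniq_min_size us sub _).2; rewrite size_iota size_std.
Qed.

Lemma oneline_perm n (pi : 'S_n) : perm_eq (oneline pi) (iota 1 n).
Proof.
have us : uniq (oneline pi).
  by rewrite map_inj_uniq ?enum_uniq // => i j [] /val_inj /perm_inj.
apply: uniq_perm => //; first exact: iota_uniq.
have sub : {subset oneline pi <= iota 1 n}.
  by move=> _ /mapP[i _ ->]; have := ltn_ord (pi i); rewrite mem_iota; lia.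
by apply: (uniq_min_size us sub _).2; rewrite size_iota size_map size_enum_ord.
Qed.

(* psi_rec k w computes psi on one-line words w of size at most k; the
   recursion equation without the bound k is psi_wordE below. *)
Fixpoint psi_rec (k : nat) (w : seq nat) : bintree :=
  if k is k'.+1 then
    if w is [::] then Leaf else
    let i := index (size w) w in
    Node (psi_rec k' (std (take i w))) (psi_rec k' (std (drop i.+1 w)))
  else Leaf.

Definition psi_word (w : seq nat) : bintree := psi_rec (size w) w.

Definition psi (n : nat) (pi : 'S_n) : bintree := psi_word (oneline pi).

Lemma psi_word_nil : psi_word [::] = Leaf.
Proof. by []. Qed.

Lemma perm_split w n : perm_eq w (iota 1 n.+1) ->
  exists l r, [/\ w = l ++ n.+1 :: r, n.+1 \notin l, uniq l, uniq r & size l + size r = n].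
Proof.
move=> pw.
have nw : n.+1 \in w by rewrite (perm_mem pw) mem_iota; lia.
have uw : uniq w by rewrite (perm_uniq pw) iota_uniq.
have sw : size w = n.+1 by rewrite (perm_size pw) size_iota.
case/splitPr: nw uw sw => l r; rewrite cat_uniq size_cat /= => /and3P[ul].
rewrite negb_or => /andP[nl _] /andP[_ ur] sw; exists l, r; split=> //; lia.
Qed.

Lemma psi_recS k n l r : perm_eq (l ++ n.+1 :: r) (iota 1 n.+1) ->
  psi_rec k.+1 (l ++ n.+1 :: r) = Node (psi_rec k (std l)) (psi_rec k (std r)).
Proof.
move=> pw.
have E w : 0 < size w -> psi_rec k.+1 w =
    let i := index (size w) w in
    Node (psi_rec k (std (take i w))) (psi_rec k (std (drop i.+1 w))) by case: w.
have sw : size (l ++ n.+1 :: r) = n.+1 by rewrite (perm_size pw) size_iota.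
have nl : n.+1 \notin l.
  have : uniq (l ++ n.+1 :: r) by rewrite (perm_uniq pw) iota_uniq.
  by rewrite cat_uniq /= negb_or => /and3P[_ /andP[]].
rewrite E sw // index_cat (negbTE nl) /= eqxx addn0 take_size_cat //.
by rewrite drop_cat ltnNge leqnSn /= subSnn /= drop0.
Qed.

Lemma psi_recE k w : perm_eq w (iota 1 (size w)) -> size w <= k ->
  psi_rec k w = psi_word w.
Proof.
rewrite /psi_word; elim/ltn_ind: k w => k IH w.
case sw: (size w) => [|n] pw wk.
  by move/size0nil: sw => ->; case: k {IH wk}.
have [l [r [ew nl ul ur sz]]] := perm_split pw.
case: k IH wk => // k IH wk; rewrite ew in pw *; rewrite !psi_recS //.
rewrite (IH k) ?(IH k _ (std r)) ?size_std ?std_perm //; try lia.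
case: (ltngtP n k) => [nk|nk|->]; try lia.
  by congr Node; rewrite [RHS]IH ?size_std ?std_perm //; lia.
by congr Node; rewrite [RHS]IH ?size_std ?std_perm //; lia.
Qed.

Lemma psi_wordE n l r : perm_eq (l ++ n.+1 :: r) (iota 1 n.+1) ->
  psi_word (l ++ n.+1 :: r) = Node (psi_word (std l)) (psi_word (std r)).
Proof.
move=> pw; rewrite {1}/psi_word (perm_size pw) size_iota psi_recS //.
have sw : size (l ++ n.+1 :: r) = n.+1 by rewrite (perm_size pw) size_iota.
have : uniq (l ++ n.+1 :: r) by rewrite (perm_uniq pw) iota_uniq.
rewrite cat_uniq /= => /and3P[ul _ /andP[_ ur]].
by move: sw; rewrite size_cat /= => sw; rewrite !psi_recE ?size_std ?std_perm //; lia.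
Qed.

Lemma nnodes_psi_word w : perm_eq w (iota 1 (size w)) -> nnodes (psi_word w) = size w.
Proof.
have [n] := ubnP (size w); elim: n w => // n IH w wn.
case sw: (size w) => [|k] pw; first by move/size0nil: sw => ->.
have [l [r [ew nl ul ur sz]]] := perm_split pw.
rewrite ew in pw *; rewrite psi_wordE //= !IH ?size_std ?std_perm //; try lia.
Qed.

Lemma nnodes_psi n (pi : 'S_n) : nnodes (psi pi) = n.
Proof.
have e : size (oneline pi) = n by rewrite size_map size_enum_ord.
by rewrite /psi nnodes_psi_word e // oneline_perm.
Qed.

Inductive preterm :=
| Gen of nat
| Comp of preterm & nat & preterm.

Fixpoint arity (A : preterm) : nat :=
  match A with
  | Gen _ => 2
  | Comp A1 _ A2 => arity A1 + arity A2 - 1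
  end.

Fixpoint indices (A : preterm) : seq nat :=
  match A with
  | Gen k => [:: k]
  | Comp A1 _ A2 => indices A1 ++ indices A2
  end.

Fixpoint well_formed (A : preterm) : bool :=
  match A with
  | Gen k => 0 < k
  | Comp A1 m A2 => [&& well_formed A1, well_formed A2 & 1 <= m <= arity A1]
  end.

Record iterm := ITerm {
  iterm_val :> preterm;
  iterm_wf : well_formed iterm_val;
  iterm_uniq : uniq (indices iterm_val)
}.

Fixpoint eval_pre (A : preterm) : bintree :=
  match A with
  | Gen _ => corolla2
  | Comp A1 m A2 => graft (eval_pre A1) m (eval_pre A2)
  end.

Definition eval (A : iterm) : bintree := eval_pre A.

Lemma nleaves_eval (A : iterm) : nleaves (eval A) = arity A.
Proof.
have := iterm_wf A; rewrite /eval; elim: (A : preterm) => //= {}A IHA m B IHB.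
case/and3P=> /IHA hA /IHB hB hm.
by rewrite nleaves_nnodes nnodes_graft ?hA // -hA -hB !nleaves_nnodes; lia.
Qed.

Record dword := DWord {
  dword_val :> seq nat;
  dword_neq0 : dword_val != [::];
  dword_pos : all (leq 1) dword_val;
  dword_uniq : uniq dword_val
}.

Definition nb_larger_left (a : seq nat) (x : nat) : nat :=
  count (fun y => x < y) (take (index x a) a).

Definition enc_letters (a : seq nat) (ks : seq nat) : preterm :=
  foldl (fun A k => Comp A (nb_larger_left a k).+1 (Gen k))
        (Gen (head 0 ks)) (behead ks).

Definition enc_pre (a : seq nat) : preterm := enc_letters a (sort geq a).

Lemma enc_lettersP (a ks : seq nat) : ks != [::] ->
  prefix ks (sort geq a) -> all (leq 1) a -> uniq a ->
  [/\ well_formed (enc_letters a ks), indices (enc_letters a ks) = ks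
    & arity (enc_letters a ks) = (size ks).+1].
Proof.
move=> + + pos ua; elim/last_ind: ks => // ks k IH _ /prefixP[s es].
have ka : k \in a by rewrite -(mem_sort geq) es mem_cat mem_rcons mem_head.
have k0 : 0 < k by apply: (allP pos).
case: ks IH es => [|x ks] IH es; first by split; rewrite /= ?k0.
have [|wf ind ar] := IH isT; first by apply/prefixP; exists (k :: s); rewrite es cat_rcons.
have -> : enc_letters a (rcons (x :: ks) k) =
   Comp (enc_letters a (x :: ks)) (nb_larger_left a k).+1 (Gen k).
  by rewrite /enc_letters /= -cats1 foldl_cat.
split; last by rewrite [LHS]/= ar size_rcons; lia.
- rewrite [well_formed _]/= wf k0 ar /= ltnS.
  have tot : total geq by move=> m n; apply: leq_total.
  have tr : transitive geq by move=> y m n /= h1 h2; apply: leq_trans h2 h1.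
  have := sort_sorted tot a; rewrite es cat_rcons sorted_pairwise //.
  rewrite pairwise_cat /= => /and3P[_ _ /andP[/allP ks_ _]].
  have c0 : count (fun y => k < y) s = 0.
    apply/eqP; rewrite -leqn0 leqNgt -has_count; apply/hasPn => y /ks_ /=; lia.
  apply: (@leq_trans (count (fun y => k < y) a)).
    by rewrite -[in leqRHS](cat_take_drop (index k a) a) count_cat leq_addr.
  rewrite -(seq.permP (permEl (perm_sort geq a))) es cat_rcons count_cat /= ltnn c0.
  rewrite !addn0; exact: (count_size _ (x :: ks)).
- by rewrite [LHS]/= ind cats1.
Qed.

Lemma sort_neq0 (a : dword) : sort geq a != [::].
Proof.
by have := dword_neq0 a; rewrite -!size_eq0 size_sort.
Qed.

Lemma enc_wf (a : dword) : well_formed (enc_pre a).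
Proof.
by have [] := enc_lettersP (sort_neq0 a) (prefix_refl _) (dword_pos a) (dword_uniq a).
Qed.

Lemma enc_uniq (a : dword) : uniq (indices (enc_pre a)).
Proof.
have [_ -> _] := enc_lettersP (sort_neq0 a) (prefix_refl _) (dword_pos a) (dword_uniq a).
by rewrite sort_uniq dword_uniq.
Qed.

Definition enc (a : dword) : iterm := ITerm (enc_wf a) (enc_uniq a).

Lemma oneline_neq0 n (hn : 1 <= n) (pi : 'S_n) : oneline pi != [::].
Proof. by rewrite -size_eq0 size_map size_enum_ord -lt0n. Qed.

Lemma oneline_pos n (pi : 'S_n) : all (leq 1) (oneline pi).
Proof. by apply/allP => _ /mapP[i _ ->]. Qed.

Lemma oneline_uniq n (pi : 'S_n) : uniq (oneline pi).
Proof. by rewrite (perm_uniq (oneline_perm pi)) iota_uniq. Qed.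

Definition perm_dword n (hn : 1 <= n) (pi : 'S_n) : dword :=
  DWord (oneline_neq0 hn pi) (oneline_pos pi) (oneline_uniq pi).

(* Main.v *)
(** Grafting the letters of a word in decreasing order builds its decreasing
    tree: once the maximal letter [M] of [l ++ M :: r] is placed at the root,
    a letter [k] of [l] sees to its left exactly the larger letters that [l]
    itself has there, while a letter [k] of [r] sees in addition [M] and all
    the letters of [l] greater than [k], together as many as the leaves of the
    left subtree at that stage. Hence the two subtrees are built independently
    by the encodings of [l] and [r]. The construction depends only on the
    relative order of the letters, so it satisfies the recursion of [psi]. *)
Require Import Defs.
From mathcomp Require Import all_boot all_fingroup.
From mathcomp Require Import zify.

Set Implicit Arguments.
Unset Strict Implicit.
Unset Printing Implicit Defensive.

Lemma geq_trans : transitive geq.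
Proof. by move=> y m n /= h1 h2; apply: leq_trans h2 h1. Qed.

Lemma geq_total : total geq.
Proof. by move=> m n; apply: leq_total. Qed.

Lemma geq_anti : antisymmetric geq.
Proof. by move=> m n /=; lia. Qed.

Lemma nleaves_graft t m s : 1 <= m <= nleaves t ->
  nleaves (graft t m s) = nleaves t + nnodes s.
Proof. by move=> hm; rewrite !nleaves_nnodes nnodes_graft. Qed.

(* Starting from [Leaf] makes the first grafting step yield the corolla of the
   maximal letter, so that the empty word needs no special treatment. *)
Definition graft_letters (a : seq nat) : bintree -> seq nat -> bintree :=
  foldl (fun t k => graft t (nb_larger_left a k).+1 corolla2).

Definition dec_tree (a : seq nat) : bintree := graft_letters a Leaf (sort geq a).

Lemma graft_letters_rcons a t ks k :
  graft_letters a t (rcons ks k) =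
  graft (graft_letters a t ks) (nb_larger_left a k).+1 corolla2.
Proof. by rewrite /graft_letters foldl_rcons. Qed.

Lemma nb_larger_left_le a k : nb_larger_left a k <= count (fun y => k < y) a.
Proof.
by rewrite -[in leqRHS](cat_take_drop (index k a) a) count_cat leq_addr.
Qed.

Lemma nb_larger_left_catl a b k : k \in a ->
  nb_larger_left (a ++ b) k = nb_larger_left a k.
Proof.
move=> ka; rewrite /nb_larger_left index_cat ka takel_cat //.
by rewrite index_size.
Qed.

Lemma nb_larger_left_catr a b k : k \notin a ->
  nb_larger_left (a ++ b) k = count (fun y => k < y) a + nb_larger_left b k.
Proof.
move=> ka; rewrite /nb_larger_left index_cat (negbTE ka) take_cat.
by rewrite ltnNge leq_addr /= addKn count_cat.
Qed.

Lemma nb_larger_left_max a M : all (geq M) a -> nb_larger_left a M = 0.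
Proof.
move=> /allP aM; apply/eqP; rewrite -leqn0.
apply: leq_trans (nb_larger_left_le _ _) _.
by rewrite leqn0 -[_ == 0]negbK -lt0n -has_count; apply/hasPn=> y /aM /=; lia.
Qed.

Lemma sort_geq_max l M r : all (geq M) (l ++ r) ->
  sort geq (l ++ M :: r) = M :: sort geq (l ++ r).
Proof.
move=> aM; apply: (sorted_eq geq_trans geq_anti).
- exact: (sort_sorted geq_total).
- rewrite /= (path_sortedE geq_trans) all_sort aM.
  exact: (sort_sorted geq_total).
- by rewrite perm_sort perm_catC /= perm_cons perm_sym perm_sort perm_catC.
Qed.

Lemma eval_enc_pre a : a != [::] -> eval_pre (enc_pre a) = dec_tree a.
Proof.
move=> a0; rewrite /enc_pre /enc_letters /dec_tree.
have := sort_sorted geq_total a; have := perm_sort geq a.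
case: (sort geq a) => [|M ks] pa.
  by move: a0; rewrite -size_eq0 -(perm_size (permEl pa)).
rewrite /= (path_sortedE geq_trans) => /andP[Mks _].
(* Position 1 is the only leaf of [Leaf]; at any other position [graft] would return [Leaf]
   unchanged. *)
have -> : nb_larger_left a M = 0.
  by apply: nb_larger_left_max; rewrite -(perm_all _ (permEl pa)) /= leqnn.
(* Reading the corolla as an evaluated term lets the induction run over an arbitrary accumulated
   term [A]. *)
rewrite /graft /= -[corolla2]/(eval_pre (Gen M)).
by elim: ks (Gen M) {pa Mks} => //= k ks IH A; rewrite IH.
Qed.

(** In decreasing order, the letters greater than [k] are those preceding it. This turns a count of
    larger letters into the number of letters of [l] already grafted. *)
Lemma count_larger_prefix (a l ks s : seq nat) k : uniq a -> uniq l ->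
  {subset l <= a} -> sort geq a = ks ++ k :: s ->
  count (fun y => k < y) l = size [seq x <- ks | x \in l].
Proof.
move=> ua ul la es.
have := sort_sorted geq_total a; rewrite es (sorted_pairwise geq_trans).
rewrite pairwise_cat /= => /and4P[/allP/= ksk _ /allP/= ks_s _].
have : uniq (ks ++ k :: s) by rewrite -es sort_uniq.
rewrite cat_uniq /= negb_or => /and4P[uks /andP[kks _] kns _].
rewrite -size_filter; apply/perm_size/uniq_perm; rewrite ?filter_uniq // => y.
rewrite !mem_filter andbC; case yl: (y \in l) => //=.
have : y \in ks ++ k :: s by rewrite -es mem_sort la.
rewrite mem_cat inE; case yks: (y \in ks) => /=.
  have := ksk _ yks; move=> /andP[+ _] _; rewrite leq_eqVlt.
  by case/orP=> // /eqP e; rewrite e yks in kks.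
by case/orP=> [/eqP->|/ks_s]; [rewrite ltnn | lia].
Qed.

(** The invariant after the root and the letters [ks] are placed. The leaf count is carried along
    because [graft] compares its position with it to choose a side. *)
Lemma graft_letters_split l M r ks s : uniq (l ++ r) -> all (geq M) (l ++ r) ->
  M \notin l ++ r -> sort geq (l ++ r) = ks ++ s ->
  nleaves (graft_letters l Leaf [seq x <- ks | x \in l]) =
    (size [seq x <- ks | x \in l]).+1 /\
  graft_letters (l ++ M :: r) corolla2 ks =
    Node (graft_letters l Leaf [seq x <- ks | x \in l])
         (graft_letters r Leaf [seq x <- ks | x \in r]).
Proof.
move=> ulr aM Ml; elim/last_ind: ks s => // ks k IH s; rewrite cat_rcons => es.
have [nl eqt] := IH _ es.
have klr : k \in l ++ r by rewrite -(mem_sort geq) es mem_cat inE eqxx orbT.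
have kM : k < M.
  have := allP aM _ klr; rewrite /= leq_eqVlt => /orP[/eqP e|//].
  by rewrite -e klr in Ml.
have [ul /hasPn disj ur] : [/\ uniq l, ~~ has (mem l) r & uniq r].
  by move: ulr; rewrite cat_uniq => /and3P[].
have cl : count (fun y => k < y) l = size [seq x <- ks | x \in l].
  apply: (count_larger_prefix ulr ul _ es) => x.
  by rewrite mem_cat => ->.
rewrite !filter_rcons graft_letters_rcons eqt /=.
case kl: (k \in l).
  have -> : (k \in r) = false by apply/negP => /disj /=; rewrite kl.
  (* The larger letters to the left of [k] are among those of [l] already grafted, so the target
     leaf lies in the left subtree. *)
  have hm : nb_larger_left l k < nleaves (graft_letters l Leaf [seq x <- ks | x \in l]).
    by rewrite nl ltnS -cl nb_larger_left_le.
  rewrite nb_larger_left_catl // hm graft_letters_rcons; split=> //.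
  by rewrite nleaves_graft // nl size_rcons addn1.
have kr : k \in r by move: klr; rewrite mem_cat kl.
(* [M] is split off to contribute its own 1; with the larger letters of [l] this is exactly the left
   leaf count that [graft] subtracts. *)
rewrite kr nb_larger_left_catr ?kl // -cat1s nb_larger_left_catr; last first.
  by rewrite inE; lia.
rewrite /= kM nl cl ifN; last by lia.
rewrite graft_letters_rcons; split=> //; congr (Node _ (graft _ _ _)); lia.
Qed.

Lemma filter_sort_geq (a b : seq nat) :
  [seq x <- sort geq a | x \in b] = sort geq [seq x <- a | x \in b].
Proof. by rewrite filter_sort //; [apply: geq_total | apply: geq_trans]. Qed.

Lemma dec_treeE l M r : uniq (l ++ r) -> all (geq M) (l ++ r) ->
  M \notin l ++ r -> dec_tree (l ++ M :: r) = Node (dec_tree l) (dec_tree r).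
Proof.
move=> ulr aM Ml; rewrite /dec_tree sort_geq_max // /=.
rewrite nb_larger_left_max; last first.
  by move: aM; rewrite !all_cat /= leqnn.
(* The invariant is taken at the full sorted list, whose restrictions to [l] and [r] are their own
   sortings. *)
have [_ ->] := graft_letters_split ulr aM Ml (esym (cats0 _)).
move: ulr; rewrite cat_uniq => /and3P[_ /hasPn disj _].
have fl : [seq x <- l ++ r | x \in l] = l.
  rewrite filter_cat [X in _ ++ X](eq_in_filter (a2 := pred0)).
    rewrite filter_pred0 cats0; exact/all_filterP/allP.
  by move=> x /disj /= /negbTE.
have fr : [seq x <- l ++ r | x \in r] = r.
  rewrite filter_cat [X in X ++ _](eq_in_filter (a2 := pred0)).
    rewrite filter_pred0; exact/all_filterP/allP.
  by move=> x xl /=; apply/negP => /disj /=; rewrite xl.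
by rewrite !filter_sort_geq fl fr.
Qed.

(** Only comparisons between letters enter the sorting and the graft positions. *)
Lemma dec_tree_map (f : nat -> nat) a :
  {in a &, {mono f : x y / x < y}} -> dec_tree (map f a) = dec_tree a.
Proof.
move=> fM.
have fL : {in a &, {mono f : x y / x <= y}}.
  by move=> x y xa ya; rewrite leqNgt fM // -leqNgt.
have nbf k : k \in a -> nb_larger_left (map f a) (f k) = nb_larger_left a k.
  move=> ka; rewrite /nb_larger_left.
  have -> : index (f k) (map f a) = index k a.
    rewrite /index find_map; apply: eq_in_find => x xa /=.
    by rewrite !eqn_leq !fL.
  rewrite -map_take count_map; apply: eq_in_count => x /mem_take xa /=.
  exact: fM.
have -> : dec_tree (map f a) = graft_letters (map f a) Leaf (map f (sort geq a)).
  congr graft_letters; apply: (sorted_eq geq_trans geq_anti).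
  - exact: (sort_sorted geq_total).
  - rewrite (mono_sorted_in (P := mem a) (e := geq)).
    + exact: (sort_sorted geq_total).
    + by move=> x y xa ya /=; apply: fL.
    + by rewrite all_sort; apply/allP.
  - by rewrite perm_sort perm_sym perm_map // perm_sort.
rewrite /dec_tree.
have : {subset sort geq a <= a} by move=> x; rewrite mem_sort.
elim: (sort geq a) Leaf => //= k ks IH t sub.
rewrite nbf ?sub ?mem_head // IH // => x xks.
by rewrite sub // inE xks orbT.
Qed.

Lemma dec_tree_std a : dec_tree (std a) = dec_tree a.
Proof.
apply: dec_tree_map => x y xa ya; rewrite ltnS.
(* Isolating [x] gives strictness: it is counted below [y] but not below itself. *)
have pa := perm_to_rem xa.
case: (ltnP x y) => xy; last first.
  by apply/negbTE; rewrite -leqNgt; apply: sub_count => z /=; lia.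
rewrite !(seq.permP pa) /= xy ltnn add0n add1n ltnS.
by apply: sub_count => z /=; lia.
Qed.

Lemma psi_word_dec_tree w : perm_eq w (iota 1 (size w)) ->
  psi_word w = dec_tree w.
Proof.
have [n] := ubnP (size w); elim: n w => // n IH w wn.
case sw: (size w) => [|k] pw; first by move/size0nil: sw => ->.
have [l [r [ew nl ul ur sz]]] := perm_split pw.
rewrite ew in pw *; rewrite psi_wordE //.
(* With the maximum in front, distinctness of the other letters and the bound on them can both be
   read off. *)
have plr : perm_eq (k.+1 :: l ++ r) (iota 1 k.+1).
  by apply: perm_trans pw; rewrite perm_sym perm_catC /= perm_cons perm_catC.
have : uniq (k.+1 :: l ++ r) by rewrite (perm_uniq plr) iota_uniq.
rewrite cons_uniq => /andP[kl ulr].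
rewrite dec_treeE //; last first.
  apply/allP => x xlr; have : x \in k.+1 :: l ++ r by rewrite inE xlr orbT.
  by rewrite (perm_mem plr) mem_iota /=; lia.
by rewrite !IH ?dec_tree_std ?size_std ?std_perm //; lia.
Qed.

Theorem theorem4p13 (n : nat) (hn : 1 <= n) (pi : 'S_n) :
  psi pi = eval (enc (perm_dword hn pi)).
Proof.
rewrite /eval /= eval_enc_pre ?oneline_neq0 // /psi psi_word_dec_tree //.
by rewrite size_map size_enum_ord oneline_perm.
Qed.
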